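(* Let $d\ge1$, $p\ge2$ and $L\ge1$ be integers. For any polynomial $P_p(\boldsymbol x)=\sum_{|\boldsymbol k|\le p}a_{\boldsymbol k}\boldsymbol x^{\boldsymbol k}$ of degree $p$ with real coefficients, $\boldsymbol x\in[-1,1]^d$, there exists $\widehat f_p^L\in\widehat{\mathcal N}^{4}_{3\binom{p+d}{d}(p-1)L}$ (with input dimension $d$) such that $$\|P_p-\widehat f_p^L\|_{L^\infty([-1,1]^d)}\le (p-1)\cdot2^{-2(L-1)}\sum_{|\boldsymbol k|\le p}|a_{\boldsymbol k}|.$$
   Context: For a multi-index $\boldsymbol k=(k_1,\dots,k_d)$ of nonnegative integers, $\boldsymbol x^{\boldsymbol k}=x_1^{k_1}\cdots x_d^{k_d}$ and $|\boldsymbol k|=\sum_{i=1}^dk_i$. Let $\sigma(t)=\mathrm{ReLU}(t)=\max\{0,t\}$, applied componentwise to vectors. For positive integers $d,L,N$, the class $\widehat{\mathcal N}_L^N$ (with input dimension $d$) is the set of functions $f:\mathbb R^d\to\mathbb R$ of the form $f^1(x)=\sigma(\widehat\theta^1(x))$, $f^\ell(x)=\sigma(\widehat\theta^\ell([x,f^{\ell-1}(x)]))$ for $\ell=2,\dots,L$, and $f(x)=\widehat\theta^{L+1}([x,f^1(x),\dots,f^L(x)])$, where $[\cdot,\cdot]$ denotes concatenation of vectors, $f^\ell(x)\in\mathbb R^N$ for $\ell=1,\dots,L$, and $\widehat\theta^1:\mathbb R^d\to\mathbb R^N$, $\widehat\theta^\ell:\mathbb R^{d+N}\to\mathbb R^N$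 ($2\le\ell\le L$), $\widehat\theta^{L+1}:\mathbb R^{d+LN}\to\mathbb R$ are arbitrary affine maps. *)

(* Defs.v *)
From HB Require Import structures.
From mathcomp Require Import all_boot all_order all_algebra.
From mathcomp Require Import all_classical all_reals all_analysis.

Set Implicit Arguments.
Unset Strict Implicit.
Unset Printing Implicit Defensive.

Import Order.TTheory GRing.Theory Num.Theory.

Local Open Scope classical_set_scope.
Local Open Scope ring_scope.

Definition is_affine (R : realType) (U V : lmodType R) (T : U -> V) : Prop :=
  exists (A : {linear U -> V}) (b : V), forall x, T x = A x + b.

Definition relu (R : realType) (n : nat) (v : 'rV[R]_n) : 'rV[R]_n :=
  \row_j Num.max 0 (v 0 j).

(* Layers are numbered from 0: [hidden theta1 theta l] is the layer f^(l+1),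
   and [theta l] is the affine map feeding the layer f^(l+2). *)
Fixpoint hidden (R : realType) (d N : nat)
    (theta1 : 'rV[R]_d -> 'rV[R]_N)
    (theta : nat -> 'rV[R]_(d + N) -> 'rV[R]_N)
    (l : nat) (x : 'rV[R]_d) : 'rV[R]_N :=
  if l is l'.+1 then relu (theta l' (row_mx x (hidden theta1 theta l' x)))
  else relu (theta1 x).

(* Only [theta 0], ..., [theta (L - 2)] affect the value of the network. *)
Definition network (R : realType) (d L N : nat) : set ('rV[R]_d -> R) :=
  [set f | exists (theta1 : 'rV[R]_d -> 'rV[R]_N)
                  (theta : nat -> 'rV[R]_(d + N) -> 'rV[R]_N)
                  (theta_out : 'rV[R]_(d + \sum_(l < L) N) -> R^o),
     [/\ is_affine theta1, forall l, is_affine (theta l), is_affine theta_out &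
         forall x, f x =
           theta_out (row_mx x (\mxrow_(l < L) hidden theta1 theta l x))]].

Definition box (R : realType) (d : nat) (a b : 'rV[R]_d) : set 'rV[R]_d :=
  [set x | forall i, a 0 i <= x 0 i <= b 0 i].

Definition cube (R : realType) (d : nat) : set 'rV[R]_d :=
  box (const_mx (-1)) (const_mx 1).
Arguments cube : clear implicits.

(* d-dimensional Lebesgue outer measure. *)
Definition lebesgue_outer (R : realType) (d : nat) (A : set 'rV[R]_d) : \bar R :=
  ereal_inf [set v : \bar R | exists a b : nat -> 'rV[R]_d,
    [/\ forall n i, a n 0 i <= b n 0 i,
        A `<=` \bigcup_n box (a n) (b n) &
        v = (\sum_(0 <= n <oo) (\prod_i (b n 0 i - a n 0 i))%:E)%E]].

(* The norm of L^oo(D): the least M >= 0 such that |g| <= M Lebesgue-almost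
   everywhere on D. *)
Definition Linfty_norm (R : realType) (d : nat) (D : set 'rV[R]_d)
    (g : 'rV[R]_d -> R) : \bar R :=
  ereal_inf [set M : \bar R | (0 <= M)%E /\
    lebesgue_outer (D `&` [set x | (M < `|g x|%:E)%E]) = 0%E].

Definition mdegree (d p : nat) (k : {ffun 'I_d -> 'I_p.+1}) : nat :=
  (\sum_i k i)%N.

(* The polynomial with coefficients [a k], |k| <= p. A multi-index with
   |k| <= p has all its entries in {0, ..., p}, hence the type of [k]. *)
Definition polynomial_fun (R : realType) (d p : nat)
    (a : {ffun 'I_d -> 'I_p.+1} -> R) (x : 'rV[R]_d) : R :=
  \sum_(k : {ffun 'I_d -> 'I_p.+1} | (mdegree k <= p)%N)
     a k * \prod_i x 0 i ^+ k i.

(* Main.v *)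
Require Import Defs.
From HB Require Import structures.
From mathcomp Require Import all_boot all_order all_algebra.
From mathcomp Require Import all_classical all_reals all_analysis.
From mathcomp Require Import zify ring lra.

Set Implicit Arguments.
Unset Strict Implicit.
Unset Printing Implicit Defensive.

Import Order.TTheory GRing.Theory Num.Theory.

Local Open Scope classical_set_scope.
Local Open Scope ring_scope.

(** The square on [0, 1] is approximated by its piecewise linear interpolant at
    the dyadic points of level m, which lies above it with error at most
    4^-(m+1).  That interpolant is t minus a weighted sum of the iterates of the
    tooth function, and one tooth costs two ReLU neurons, so the next layer of a
    network can refine the interpolant by one level ([saw_squareS],
    [saw_square_bounds]).

    Products reduce to squares by polarization,
      x y = |(x + y) / 2|^2 - |(x - y) / 2|^2.
    If x and y lie in [-1, 1], both arguments lie in [0, 1], and so do both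
    interpolants; their difference is therefore again in [-1, 1] and can be fed
    into the next product without clipping.  The two errors have the same sign,
    so a product has error at most 4^-(m+1) as well ([saw_mulP]).

    Width four is enough to run a square: two neurons carry the current tooth,
    one the partial sum of the interpolant, and one a value needed later
    ([runs_square]).  The two squares of a product are computed one after the
    other; the fourth neuron carries the product so far during the first square
    and the value of the first square during the second one ([runs_mul]).  With
    m = L - 1, a product takes 2 L layers and has error at most 4^-L.  A
    monomial of degree at most p needs at most p - 1 products, and multiplying
    by coordinates of absolute value at most 1 does not amplify earlier errors
    ([runs_prod]).

    The output of the network is affine in all the layers, so each monomial can
    be added to the output as soon as it is known and its layers then reused
    from scratch ([runs_output], [runs_poly]).  There are 'C(p + d, d)
    monomials, so the depth 2 'C(p + d, d) (p - 1) L is reached with error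
    (p - 1) 4^-L times the sum of the |a_k|; idle layers fill up the rest. *)

(** * Sawtooth approximation of the square *)

Section Square.
Context {R : realType}.
Implicit Types (t x y : R) (m : nat).

(** On [0, 1] this is the tent map, equal to 2 t up to 1/2 and to 2 - 2 t
    beyond, in the form in which two ReLU neurons compute it. *)
Definition tooth t : R := 2 * Num.max 0 t - 4 * Num.max 0 (t - 2^-1).

Fixpoint saw_square m t : R :=
  if m is m'.+1 then saw_square m' t - 4 ^- m * iter m tooth t else t.

Lemma tooth_itv t : 0 <= t <= 1 -> 0 <= tooth t <= 1.
Proof.
rewrite /tooth => /andP[t0 t1]; rewrite max_r//.
by have [h|h] := leP (t - 2^-1) 0; lra.
Qed.

Lemma iter_tooth_itv m t : 0 <= t <= 1 -> 0 <= iter m tooth t <= 1.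
Proof. by move=> t01; elim: m => //= m; exact: tooth_itv. Qed.

(** The self-similarity of the parabola: on either half of [0, 1], its gap to
    the chord is a copy, scaled by 1/4, of the gap t - t^2 on [0, 1]. *)
Lemma sqr_tooth t : 0 <= t <= 1 -> t ^+ 2 = t - tooth t / 2 + tooth t ^+ 2 / 4.
Proof.
rewrite /tooth => /andP[t0 t1]; rewrite (max_r t0).
by have [h|h] := leP (t - 2^-1) 0; field.
Qed.

(** The interpolants satisfy the same recursion as the square ([sqr_tooth]), one
    level apart; hence each level divides the error by four.  This peels off
    the first tooth, whereas the definition adds the last one. *)
Lemma saw_squareS m t :
  saw_square m.+1 t = t - tooth t / 2 + saw_square m (tooth t) / 4.
Proof.
elim: m => [|m IH]; first by rewrite /=; field.
rewrite [LHS]/= -iterS -/(saw_square m.+1 t) IH [saw_square m.+1 _]/=.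
rewrite -!iterS -iterSr (exprS 4 m.+1) invfM.
set a := saw_square _ _; set b := iter _ _ _; set c := _ ^- _; lra.
Qed.

Lemma saw_square_bounds m t : 0 <= t <= 1 ->
  t ^+ 2 <= saw_square m t <= t /\ saw_square m t <= t ^+ 2 + 4 ^- m.+1.
Proof.
elim: m t => [|m IH] t t01.
  have := sqr_ge0 (t - 2^-1); rewrite sqrrB /= !expr2; nra.
have t01' := tooth_itv t01.
have [/andP[l1 l2] l3] := IH _ t01'.
rewrite saw_squareS (sqr_tooth t01) (exprS 4 m.+1) invfM.
move: (saw_square _ _) (4 ^- _) l1 l2 l3 => a c l1 l2 l3.
split; [apply/andP; split|]; lra.
Qed.

Definition saw_mul m x y : R :=
  saw_square m `|(x + y) / 2| - saw_square m `|(x - y) / 2|.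

Lemma half_sum_itv x y : `|x| <= 1 -> `|y| <= 1 -> 0 <= `|(x + y) / 2| <= 1.
Proof. by rewrite normr_ge0 !ler_norml => /andP[? ?] /andP[? ?] /=; lra. Qed.

(** Polarization subtracts two overestimates by at most 4^-(m+1), so the errors
    do not add up.  The first bound is what allows products to be chained. *)
Lemma saw_mulP m x y : `|x| <= 1 -> `|y| <= 1 ->
  `|saw_mul m x y| <= 1 /\ `|saw_mul m x y - x * y| <= 4 ^- m.+1.
Proof.
move=> x1 y1; rewrite /saw_mul.
have p01 := half_sum_itv x1 y1.
have q01 : 0 <= `|(x - y) / 2| <= 1 by apply: half_sum_itv; rewrite ?normrN.
have -> : x * y = `|(x + y) / 2| ^+ 2 - `|(x - y) / 2| ^+ 2.
  by rewrite -!normrX !ger0_norm ?sqr_ge0//; field.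
have [] := saw_square_bounds m p01; have [] := saw_square_bounds m q01.
move: p01 q01 (sqr_ge0 `|(x + y) / 2|) (sqr_ge0 `|(x - y) / 2|).
move: `|(x + y) / 2| `|(x - y) / 2| => p q.
move: (p ^+ 2) (q ^+ 2) (saw_square _ _) (saw_square _ _) (4 ^- _) => *.
by split; rewrite ler_norml; lra.
Qed.

End Square.

(** * Running a network layer by layer *)

Section Machine.
Context {R : realType} {d N : nat}.
Implicit Types (x : 'rV[R]_d) (h : 'rV[R]_d -> 'rV[R]_N) (f u v : 'rV[R]_d -> R).

(** The two matrices of a layer act on the input and on the previous layer. *)
Definition layer : Type := ('M[R]_(d, N) * 'M[R]_N * 'rV[R]_N)%type.

(** Starting from the zero vector makes the first layer, which only sees the
    input, an instance of the same recursion as the other ones. *)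
Fixpoint state (W : nat -> layer) (n : nat) x : 'rV[R]_N :=
  if n is n'.+1
  then relu (x *m (W n').1.1 + state W n' x *m (W n').1.2 + (W n').2)
  else 0.

Definition readout (W : nat -> layer) (c : nat -> 'cV[R]_N) (a : 'cV[R]_d)
    (b : R) (n : nat) x : R :=
  (x *m a) 0 0 + b + \sum_(l < n) (state W l.+1 x *m c l) 0 0.

Lemma eq_state W W' n x :
  (forall l, (l < n)%N -> W l = W' l) -> state W n x = state W' n x.
Proof.
elim: n => //= n IH eqW; rewrite eqW// IH// => l ln.
by rewrite eqW// ltnS ltnW.
Qed.

Lemma affine_mulmx m k (A : 'M[R]_(m, k)) (b : 'rV[R]_k) :
  is_affine (fun y : 'rV[R]_m => y *m A + b).
Proof. by exists (mulmxr A), b. Qed.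

Definition mulmx_entry m (A : 'cV[R]_m) (y : 'rV[R]_m) : R^o := (y *m A) 0 0.

Fact mulmx_entry_is_linear m (A : 'cV[R]_m) : linear (mulmx_entry A).
Proof. by move=> k y z; rewrite /mulmx_entry mulmxDl -scalemxAl !mxE. Qed.

HB.instance Definition _ m (A : 'cV[R]_m) :=
  GRing.isLinear.Build R 'rV[R]_m R^o *:%R (mulmx_entry A)
    (mulmx_entry_is_linear A).

(** Stacking the matrices that act on the input and on the hidden layers gives
    affine maps on concatenated vectors. *)
Lemma network_readout W c a b n : network n.+1 N (readout W c a b n.+1).
Proof.
pose theta1 x := x *m (W 0%N).1.1 + (W 0%N).2.
pose theta l (y : 'rV[R]_(d + N)) :=
  y *m col_mx (W l.+1).1.1 (W l.+1).1.2 + (W l.+1).2.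
have hiddenE l x : hidden theta1 theta l x = state W l.+1 x.
  elim: l => [|l IH]; first by rewrite /= /theta1 mul0mx addr0.
  by rewrite [LHS]/= IH /theta mul_row_col.
exists theta1, theta,
  (fun y => mulmx_entry (col_mx a (\mxcol_(l < n.+1) c l)) y + b); split.
- exact: affine_mulmx.
- by move=> l; exact: affine_mulmx.
- by eexists; exists b.
- move=> x; rewrite /mulmx_entry mul_row_col mul_mxrow_mxcol mxE summxE.
  rewrite /readout addrAC; congr (_ + _ + _).
  by apply: eq_bigr => l _; rewrite hiddenE.
Qed.

Variable D : set 'rV[R]_d.

(** Some network reaches the state h after n layers and can output f by then.
    Only the values on D count, because the bounds that the construction relies
    on fail elsewhere. *)
Definition runs n h f : Prop := exists W c a b,
  forall x, D x -> state W n x = h x /\ readout W c a b n x = f x.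

(** The functions that the next layer can use as preactivations and that the
    output can add to its value. *)
Definition readable h u : Prop := exists (a : 'cV[R]_d) (c : 'cV[R]_N) (b : R),
  forall x, D x -> u x = (x *m a) 0 0 + (h x *m c) 0 0 + b.

Lemma readable_ext h u v :
  (forall x, D x -> u x = v x) -> readable h u -> readable h v.
Proof.
by move=> uv [a [c [b H]]]; exists a, c, b => x Dx; rewrite -uv// H.
Qed.

Lemma readable_cst h (k : R) : readable h (fun=> k).
Proof. by exists 0, 0, k => x _; rewrite !mulmx0 !mxE !add0r. Qed.

Lemma readable_input h i : readable h (fun x => x 0 i).
Proof.
by exists (delta_mx i 0), 0, 0 => x _; rewrite mulmx0 -colE !mxE !addr0.
Qed.

Lemma readable_state h j : readable h (fun x => h x 0 j).
Proof.
by exists 0, (delta_mx j 0), 0 => x _; rewrite mulmx0 -colE !mxE addr0 add0r.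
Qed.

Lemma readableD h u v :
  readable h u -> readable h v -> readable h (fun x => u x + v x).
Proof.
move=> [a [c [b H]]] [a' [c' [b' H']]]; exists (a + a'), (c + c'), (b + b').
by move=> x Dx; rewrite H// H'// !mulmxDr !mxE; ring.
Qed.

Lemma readableZ h (k : R) u : readable h u -> readable h (fun x => k * u x).
Proof.
move=> [a [c [b H]]]; exists (k *: a), (k *: c), (k * b).
by move=> x Dx; rewrite H// -!scalemxAr !mxE; ring.
Qed.

Lemma readableN h u : readable h u -> readable h (fun x => - u x).
Proof.
by move=> /(readableZ (-1)); apply: readable_ext => x _; rewrite mulN1r.
Qed.

Lemma runs0 : runs 0 (fun=> 0) (fun=> 0).
Proof.
exists (fun=> 0), (fun=> 0), 0, 0 => x _.
by rewrite /readout mulmx0 mxE big_ord0 !addr0.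
Qed.

Lemma runs_step n h f (u : 'I_N -> 'rV[R]_d -> R) :
    runs n h f -> (forall j, readable h (u j)) ->
  runs n.+1 (fun x => \row_j Num.max 0 (u j x)) f.
Proof.
move=> [W [c [a [b Hr]]]] /choice[A] /choice[C] /choice[B] Hu.
pose W' l := if l == n
  then (\matrix_(i, j) A j i 0, \matrix_(i, j) C j i 0, \row_j B j) else W l.
pose c' l := if l == n then 0 else c l.
exists W', c', a, b => x Dx; have [hx fx] := Hr x Dx.
have W'E l : (l <= n)%N -> state W' l x = state W l x.
  move=> ln; apply: eq_state => k kl.
  by rewrite /W' ltn_eqF// (leq_trans kl).
split.
  apply/rowP => j; rewrite /= W'E// hx /W' eqxx /relu !mxE Hu//.
  rewrite !mxE; congr (Num.max _ (_ + _ + _)).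
    by apply: eq_bigr => i _; rewrite mxE.
  by apply: eq_bigr => i _; rewrite mxE.
rewrite -fx /readout big_ord_recr [X in _ + (_ + X)]/= /c' eqxx mulmx0.
rewrite [X in _ + (_ + X)]mxE addr0.
congr (_ + _); apply: eq_bigr => l _.
by rewrite W'E//= ltn_eqF.
Qed.

(** A readout of the last layer is absorbed into the output coefficients of that
    layer; the layer is then free to be overwritten. *)
Lemma runs_output n h f u :
  runs n h f -> readable h u -> runs n h (fun x => f x + u x).
Proof.
move=> [W [c [a [b Hr]]]] [a' [c' [b' Hu]]].
pose c1 l := if l.+1 == n then c l + c' else c l.
exists W, c1, (a + a'), (b + b') => x Dx; have [hx fx] := Hr x Dx.
have entryD (A B : 'M[R]_1) : (A + B) 0 0 = A 0 0 + B 0 0 by rewrite mxE.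
split=> //; rewrite -fx Hu// -hx /readout mulmxDr entryD /c1.
(* Before the first layer the state vanishes: u is affine in the input. *)
case: n {Hr hx fx c1} => [|n] /=.
  by rewrite mul0mx [X in _ + (_ + X + _)]mxE !big_ord0; ring.
rewrite !big_ord_recr /= eqxx mulmxDr entryD.
rewrite (eq_bigr (fun l : 'I_n => (state W l.+1 x *m c l) 0 0)); first by ring.
by move=> l _; rewrite eqSS ltn_eqF.
Qed.

Lemma runs_pad n h f k : runs n h f -> exists h', runs (n + k) h' f.
Proof.
move=> r; elim: k => [|k [h' r']]; first by rewrite addn0; exists h.
rewrite addnS; eexists; apply: (runs_step r' (u := fun=> fun=> 0)) => j.
exact: readable_cst.
Qed.

Lemma runs_network n h f : (0 < n)%N -> runs n h f ->
  exists2 g, network n N g & forall x, D x -> g x = f x.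
Proof.
case: n => // n _ [W [c [a [b H]]]].
by exists (readout W c a b n.+1); [exact: network_readout|move=> x /H[]].
Qed.

End Machine.

(** * Width four: squares, products and monomials *)

Section WidthFour.
Context {R : realType} {d : nat} {D : set 'rV[R]_d}.
Implicit Types (h : 'rV[R]_d -> 'rV[R]_4) (f u v c : 'rV[R]_d -> R).

Lemma runs_step4 n h f (u0 u1 u2 u3 : 'rV[R]_d -> R) :
    runs D n h f -> readable D h u0 -> readable D h u1 -> readable D h u2 ->
    readable D h u3 ->
  exists h', runs D n.+1 h' f /\
    [/\ readable D h' (fun x => Num.max 0 (u0 x)),
        readable D h' (fun x => Num.max 0 (u1 x)),
        readable D h' (fun x => Num.max 0 (u2 x)) &
        readable D h' (fun x => Num.max 0 (u3 x))].
Proof.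
move=> r r0 r1 r2 r3.
pose u (j : 'I_4) := nth u0 [:: u0; u1; u2; u3] j.
have ru j : readable D h (u j) by case: j => -[|[|[|[|//]]]] jlt.
exists (fun x => \row_j Num.max 0 (u j x)); split; first exact: (runs_step r ru).
have rd j : readable D (fun x => \row_j Num.max 0 (u j x))
    (fun x => Num.max 0 (u j x)).
  by apply: readable_ext (readable_state D _ j) => x _; rewrite mxE.
split; [exact: (rd (Ordinal (isT : 0 < 4)%N))|exact: (rd (Ordinal (isT : 1 < 4)%N))|
  exact: (rd (Ordinal (isT : 2 < 4)%N))|exact: (rd (Ordinal (isT : 3 < 4)%N))].
Qed.

(** A ReLU neuron transmits a bounded value once it is shifted to be
    nonnegative. *)
Lemma readable_carry h c : (forall x, D x -> `|c x| <= 1) ->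
  readable D h (fun x => Num.max 0 (c x + 1)) -> readable D h c.
Proof.
move=> c1 /readableD /(_ (readable_cst D h (-1))); apply: readable_ext => x Dx.
by move: (c1 x Dx); rewrite ler_norml => /andP[? _]; rewrite max_r ?addrK//; lra.
Qed.

(** The value c is an arbitrary bounded quantity kept alive during the
    computation, such as an operand or a result that is needed later. *)
Lemma runs_square m n h f u c :
    (forall x, D x -> `|u x| <= 1) -> (forall x, D x -> `|c x| <= 1) ->
    runs D n h f -> readable D h u -> readable D h c ->
  exists h', [/\ runs D (n + m.+1) h' f,
    readable D h' (fun x => saw_square m `|u x|) & readable D h' c].
Proof.
move=> u1 c1 r ru rc.
(* The current tooth has to be kept as well in order to compute the next. *)
suff [h' [? [_ ? ?]]] : exists h', runs D (n + m.+1) h' f /\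
    [/\ readable D h' (fun x => iter m tooth `|u x|),
        readable D h' (fun x => saw_square m `|u x|) & readable D h' c].
  by exists h'.
elim: m => [|m [h' [r' [rt rs rc']]]].
  (* The first layer spends its two tooth neurons on the absolute value. *)
  have [h' [r' [r0 r1 r2 _]]] := runs_step4 r ru (readableN ru)
    (readableD rc (readable_cst D h 1)) (readable_cst D h 0).
  have rn : readable D h' (fun x => `|u x|).
    apply: readable_ext (readableD r0 r1) => x _.
    by have [h0|h0] := ger0P (u x); have [|] := leP 0 (- u x);
      have [|] := leP 0 (u x); lra.
  by exists h'; rewrite addn1; do 2?split => //; exact: readable_carry r2.
have [h2 [r2 [s0 s1 s2 s3]]] := runs_step4 r' rt
  (readableD rt (readable_cst D h' (- 2^-1)))
  (readableD rc' (readable_cst D h' 1)) rs.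
have rt2 : readable D h2 (fun x => iter m.+1 tooth `|u x|).
  apply: readable_ext (readableD (readableZ 2 s0) (readableZ (-4) s1)) => x _.
  by rewrite /= /tooth mulNr.
exists h2; rewrite addnS; split=> //; split=> //; last exact: readable_carry s2.
(* The partial sum is at least (u x)^2, so that the ReLU transmits it. *)
apply: readable_ext (readableD s3 (readableZ (- 4 ^- m.+1) rt2)) => x Dx.
have u01 : 0 <= `|u x| <= 1 by rewrite normr_ge0 u1.
have [/andP[s _] _] := saw_square_bounds m u01.
by rewrite max_r ?mulNr// (le_trans _ s)// sqr_ge0.
Qed.

(** The factor u occupies the carried slot, while v has to be readable from
    every state: during the first square nothing is left to carry it.  In a
    monomial, v is a coordinate of the input. *)
Lemma runs_mul m n h f u v :
    (forall x, D x -> `|u x| <= 1) -> (forall x, D x -> `|v x| <= 1) ->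
    runs D n h f -> readable D h u -> (forall h', readable D h' v) ->
  exists h', runs D (n + 2 * m.+1) h' f /\
    readable D h' (fun x => saw_mul m (v x) (u x)).
Proof.
move=> u1 v1 r ru rv.
have p1 x : D x -> `|2^-1 * (v x + u x)| <= 1.
  move=> Dx; have := half_sum_itv (v1 x Dx) (u1 x Dx).
  by rewrite mulrC => /andP[].
have q1 x : D x -> `|2^-1 * (v x + - u x)| <= 1.
  move=> Dx; have := half_sum_itv (v1 x Dx) (y := - u x).
  by rewrite normrN mulrC => /(_ (u1 x Dx)) /andP[].
have [h1 [r1 rs1 ru1]] := runs_square m p1 u1 r (readableZ _ (readableD (rv h) ru)) ru.
have s1 x : D x -> `|saw_square m `|2^-1 * (v x + u x)| | <= 1.
  move=> Dx; have p01 : 0 <= `|2^-1 * (v x + u x)| <= 1 by rewrite normr_ge0 p1.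
  have [/andP[l1 l2] _] := saw_square_bounds m p01.
  by rewrite ger0_norm ?(le_trans _ l1) ?sqr_ge0// (le_trans l2)// p1.
have [h2 [r2 rs2 ru2]] := runs_square m q1 s1 r1
  (readableZ _ (readableD (rv h1) (readableN ru1))) rs1.
exists h2; rewrite mul2n -addnn addnA; split=> //.
apply: readable_ext (readableD ru2 (readableN rs2)) => x _.
by rewrite /saw_mul ![2^-1 * _]mulrC.
Qed.

Hypothesis D_unit : forall x i, D x -> `|x 0 i| <= 1.

(** The first factor i is read off the input, so only the factors in s cost a
    product.  A new factor of absolute value at most 1 does not increase the
    error so far, and adds the error of one product. *)
Lemma runs_prod m n h f i (s : seq 'I_d) : runs D n h f ->
  exists h' y, [/\ runs D (n + size s * (2 * m.+1)) h' f, readable D h' y &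
    forall x, D x -> `|y x| <= 1 /\
      `|y x - \prod_(j <- i :: s) x 0 j| <= (size s)%:R * 4 ^- m.+1].
Proof.
move=> r; elim: s => [|j s [h' [y [r' ry yP]]]].
  exists h, (fun x => x 0 i); split; rewrite ?mul0n ?addn0//.
    exact: readable_input.
  move=> x Dx; rewrite big_seq1 subrr normr0 mul0r; split=> //; exact: D_unit.
have [h2 [r2 ry2]] := runs_mul m (fun x Dx => (yP x Dx).1)
  (fun x Dx => D_unit j Dx) r' ry (fun h' => readable_input D h' j).
exists h2, (fun x : 'rV_d => saw_mul m (x 0 j) (y x)); split => //.
  by rewrite /= mulSn addnCA addnC.
move=> x Dx; have [y1 yE] := yP x Dx; have xj := D_unit j Dx.
have [z1 zE] := saw_mulP m xj y1; split=> //.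
have -> : \prod_(j <- [:: i, j & s]) x 0 j = x 0 j * \prod_(j <- i :: s) x 0 j.
  by rewrite !big_cons mulrCA.
rewrite (le_trans (ler_distD (x 0 j * y x) _ _))//= -mulrBr normrM.
rewrite -[(size s).+1%:R]natr1 [_ + 1]addrC mulrDl mul1r lerD// (le_trans _ yE)//.
by rewrite ler_piMl.
Qed.

Lemma runs_monomial p m n h f (s : seq 'I_d) : (size s <= p.+1)%N ->
    runs D n h f ->
  exists h' y, [/\ runs D (n + p * (2 * m.+1)) h' f, readable D h' y &
    forall x, D x -> `|y x - \prod_(j <- s) x 0 j| <= p%:R * 4 ^- m.+1].
Proof.
have e0 : 0 <= 4 ^- m.+1 :> R by rewrite invr_ge0 exprn_ge0.
case: s => [|i s] sp r.
  have [h' r'] := runs_pad (p * (2 * m.+1)) r.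
  exists h', (fun=> 1); split=> //; first exact: readable_cst.
  by move=> x _; rewrite big_nil subrr normr0 mulr_ge0.
(* Idling first makes the number of layers independent of the degree. *)
pose t := ((p - size s) * (2 * m.+1))%N.
have [h1 r1] := runs_pad t r.
have [h2 [y [r2 ry yP]]] := runs_prod m i s r1.
exists h2, y; split=> //; first by move: r2; rewrite -addnA /t -mulnDl subnK.
move=> x Dx; have [_ /le_trans] := yP x Dx; apply.
by rewrite ler_wpM2r// ler_nat.
Qed.

Lemma runs_poly (I : Type) (p m : nat) (a : I -> R) (s : I -> seq 'I_d)
    (ks : seq I) : all (fun k => size (s k) <= p.+1)%N ks ->
  exists h f, runs D (size ks * (p * (2 * m.+1))) h f /\
    forall x, D x -> `|f x - \sum_(k <- ks) a k * \prod_(j <- s k) x 0 j| <=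
      p%:R * 4 ^- m.+1 * \sum_(k <- ks) `|a k|.
Proof.
elim: ks => [_|k ks IH /= /andP[sk /IH[h [f [r fP]]]]].
  exists (fun=> 0), (fun=> 0); split; first exact: runs0.
  by move=> x _; rewrite !big_nil subrr normr0 mulr0.
have [h' [y [r' ry yP]]] := runs_monomial m sk r.
exists h', (fun x => f x + a k * y x); split.
  by rewrite mulSn addnC; exact: runs_output r' (readableZ _ ry).
move=> x Dx; rewrite !big_cons mulrDr [X in X - _]addrC opprD addrACA -mulrBr.
apply: (le_trans (ler_normD _ _)); rewrite lerD ?fP//.
by rewrite normrM mulrC ler_wpM2r// yP.
Qed.

End WidthFour.

(** * Multi-indices and the essential supremum *)

Section MultiIndex.
Context {d p : nat}.
Implicit Type k : {ffun 'I_d -> 'I_p.+1}.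

(** The monomial of exponent k as a word in the variables, the form in which its
    factors are multiplied one by one. *)
Definition variables k : seq 'I_d :=
  flatten [seq nseq (k i) i | i <- enum 'I_d].

Lemma size_variables k : size (variables k) = mdegree k.
Proof.
rewrite size_flatten /shape -map_comp sumnE big_map big_enum /mdegree.
by apply: eq_bigr => i _ /=; rewrite size_nseq.
Qed.

Lemma prod_variables (S : comNzRingType) k (x : 'I_d -> S) :
  \prod_(j <- variables k) x j = \prod_i x i ^+ k i.
Proof.
rewrite /variables big_flatten big_map big_enum.
by apply: eq_bigr => i _; rewrite big_nseq -Monoid.iteropE.
Qed.

(** Multi-indices are tuples, and the tuples of bounded sum are counted by
    [card_partial_ord_partitions]. *)
Lemma card_mdegree_le :
  #|[pred k : {ffun 'I_d -> 'I_p.+1} | (mdegree k <= p)%N]| = 'C(p + d, d).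
Proof.
pose tup k : d.-tuple 'I_p.+1 := [tuple k i | i < d].
have tupK : cancel tup (fun t => [ffun i => tnth t i]).
  by move=> k; apply/ffunP => i; rewrite ffunE tnth_mktuple.
have sum_tup k : (\sum_(j <- tup k) j = mdegree k)%N.
  by rewrite big_tuple; apply: eq_bigr => i _; rewrite tnth_mktuple.
rewrite addnC -card_partial_ord_partitions -(card_imset _ (can_inj tupK)).
apply: eq_card => t; rewrite !inE; apply/imsetP/idP => [[k kp ->]|tp].
  by rewrite sum_tup.
have tE : t = tup [ffun i => tnth t i].
  by apply: eq_from_tnth => i; rewrite tnth_mktuple ffunE.
by exists [ffun i => tnth t i]; rewrite ?inE -?sum_tup -?tE.
Qed.

End MultiIndex.

Section EssentialSupremum.
Local Open Scope ereal_scope.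
Context {R : realType} {d : nat}.

(** Degenerate boxes cover the empty set with volume zero; in dimension zero
    their volume would be an empty product, equal to one. *)
Lemma lebesgue_outer_set0 : (0 < d)%N -> lebesgue_outer (R := R) (d := d) set0 = 0.
Proof.
move=> d0; apply/eqP; rewrite eq_le; apply/andP; split.
  apply: ereal_inf_lbound; exists (fun=> 0%R), (fun=> 0%R); split => //.
  rewrite eseries0// => n _ _; rewrite (bigD1 (Ordinal d0))//=.
  by rewrite subrr mul0r.
apply: le_ereal_inf_tmp => _ [a [b [ab _ ->]]]; apply: nneseries_ge0 => n _ _.
by rewrite lee_fin prodr_ge0// => i _; rewrite subr_ge0.
Qed.

Lemma Linfty_norm_le (D : set 'rV[R]_d) (g : 'rV[R]_d -> R) (M : R) :
    (0 < d)%N -> (0 <= M)%R -> (forall x, D x -> `|g x| <= M)%R ->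
  Linfty_norm D g <= M%:E.
Proof.
move=> d0 M0 gM; apply: ereal_inf_lbound; split; first by rewrite lee_fin.
rewrite (_ : _ `&` _ = set0) ?lebesgue_outer_set0//.
apply/seteqP; split=> // x [/gM gx] /=.
by rewrite lte_fin ltNge gx.
Qed.

End EssentialSupremum.

Theorem lemma4p6 (R : realType) (d p L : nat)
    (hd : (1 <= d)%N) (hp : (2 <= p)%N) (hL : (1 <= L)%N)
    (a : {ffun 'I_d -> 'I_p.+1} -> R) :
  exists2 f : 'rV[R]_d -> R,
    network (3 * 'C(p + d, d) * (p - 1) * L)%N 4%N f &
    (Linfty_norm (cube R d) (fun x => (polynomial_fun a x - f x)%R) <=
     ((p - 1)%N%:R * 2 ^- (2 * (L - 1)) *
      \sum_(k : {ffun 'I_d -> 'I_p.+1} | (mdegree k <= p)%N) `|a k|)%R%:E)%E.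
Proof.
(* From here on, p and L stand for p - 1 and L - 1. *)
case: p hp a => // p hp a; case: L hL => // L _; rewrite !subn1 /=.
have cube1 (x : 'rV[R]_d) i : cube R d x -> `|x 0 i| <= 1.
  by rewrite ler_norml => /(_ i); rewrite !mxE.
pose ks := enum [pred k : {ffun 'I_d -> 'I_p.+2} | (mdegree k <= p.+1)%N].
have size_ks : size ks = 'C(p.+1 + d, d) by rewrite -cardE card_mdegree_le.
have ks_deg : all (fun k => size (variables k) <= p.+1)%N ks.
  by apply/allP => k; rewrite mem_enum size_variables.
have [h [f [r fP]]] := runs_poly cube1 L a ks_deg.
pose n := (3 * 'C(p.+1 + d, d) * p * L.+1)%N.
have depth : (size ks * (p * (2 * L.+1)) <= n)%N by rewrite size_ks /n; nia.
have [h' r'] := runs_pad (n - size ks * (p * (2 * L.+1))) r.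
rewrite subnKC// in r'.
have n0 : (0 < n)%N by rewrite !muln_gt0 bin_gt0 leq_addl /= andbT; exact: hp.
have [g netg gf] := runs_network n0 r'.
exists g => //; apply: Linfty_norm_le => //.
  by rewrite mulr_ge0 ?sumr_ge0// mulr_ge0// invr_ge0 exprn_ge0.
move=> x Dx; rewrite gf// distrC.
have -> : polynomial_fun a x = \sum_(k <- ks) a k * \prod_(j <- variables k) x 0 j.
  rewrite /polynomial_fun big_enum; apply: eq_bigr => k _.
  by rewrite (prod_variables _ (fun j => x 0 j)).
apply: (le_trans (fP x Dx)); rewrite big_enum ler_wpM2r ?sumr_ge0//.
rewrite ler_wpM2l// exprM (_ : 2 ^+ 2 = 4 :> R); last by ring.
by rewrite lef_pV2 ?posrE ?exprn_gt0// ler_eXn2l ?ltr1n.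
Qed.
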